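(* Let $\mathcal{H}$ be a finite-dimensional complex Hilbert space, let $\rho$ be a quantum state on $\mathcal{H}$, let $\Pi=\{\Pi_x\}_{x\in X}$ be a von Neumann measurement on $\mathcal{H}$ with $|X|=n$, and let $a\in(0,\frac1n)$. Let $\Lambda^{(a)}_u=\{\Lambda^{(a)}_{u,x}\}_{x\in X}$ be the logically reversible measurement induced by $\Pi$, namely $$\Lambda^{(a)}_{u,x}=(1-(n-1)a)\,\Pi_x+\sum_{y\neq x}a\,\Pi_y .$$ Let $p(x)=\mathrm{Tr}(\Pi_x\rho)$ and $p^{(a)}_u(x)=\mathrm{Tr}(\Lambda^{(a)}_{u,x}\rho)=(1-na)p(x)+a$ for $x\in X$, and let $f(t)=-t\log_2 t$. Then $$H(p^{(a)}_u)-n\,\max\{f(a),\,f(1-na+a)\}\;\le\; H(p)\;\le\; H(p^{(a)}_u).$$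
   Context: A quantum state on $\mathcal{H}$ is a positive semidefinite operator of trace one. A von Neumann measurement is a finite family $\{\Pi_x\}_{x\in X}$ of mutually orthogonal (self-adjoint) projectors with $\sum_{x\in X}\Pi_x=\mathbb{1}_{\mathcal{H}}$. The Shannon entropy of a probability distribution $p=\{p(x)\}_{x\in X}$ is $H(p)=-\sum_{x\in X}p(x)\log_2p(x)$, with the convention $0\log_2 0=0$. *)

(* Defs.v *)
From HB Require Import structures.
From mathcomp Require Import all_boot all_order all_algebra.
From mathcomp Require Import complex.
From mathcomp Require Import boolp classical_sets reals exp.

Set Implicit Arguments.
Unset Strict Implicit.
Unset Printing Implicit Defensive.

Import Order.TTheory GRing.Theory Num.Theory.

Local Open Scope ring_scope.
Local Open Scope complex_scope.

(* A finite-dimensional complex Hilbert space is a vectType over R[i] with a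
   positive definite Hermitian form, linear in its first argument and
   conjugate-linear in its second. Operators are the elements of 'End(V). *)
Notation inner_product V := {dot V for (@Num.conj _)}.

Section Trace.
Variables (F : fieldType) (V : vectType F).

Definition lftrace (A : 'End(V)) : F :=
  \tr (passmx.mxof (vbasis {:V}) (vbasis {:V}) A).

(* The basis chosen in the definition of lftrace is immaterial. *)
Lemma lftrace_basis (e : (\dim {:V}).-tuple V) (A : 'End(V)) :
  basis_of {:V} e -> lftrace A = \tr (passmx.mxof e e A).
Proof.
move=> eP; have bP := vbasisP {:V}; rewrite /lftrace.
set b := vbasis _ in bP *.
have -> : passmx.mxof e e A =
    passmx.mxof e b \1 *m passmx.mxof b b A *m passmx.mxof b e \1.
  by rewrite -(passmx.mxof_comp _ _ bP) -(passmx.mxof_comp _ _ bP)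
    comp_lfun1l comp_lfun1r.
by rewrite -mulmxA mxtrace_mulC -mulmxA -(passmx.mxof_comp _ _ eP) comp_lfun1l
  passmx.mxof1 ?mulmx1 // (basis_free bP).
Qed.

End Trace.

Section Operators.
Variables (R : realType) (V : vectType R[i]) (dot : inner_product V).

Definition self_adjoint (A : 'End(V)) : Prop :=
  forall u v : V, dot (A u) v = dot u (A v).

(* In the order of R[i], 0 <= z means that z is real and nonnegative. *)
Definition positive_semidefinite (A : 'End(V)) : Prop :=
  self_adjoint A /\ forall v : V, 0 <= dot (A v) v.

Definition quantum_state (rho : 'End(V)) : Prop :=
  positive_semidefinite rho /\ lftrace rho = 1.

Definition projector (P : 'End(V)) : Prop :=
  self_adjoint P /\ (P \o P)%VF = P.

Definition von_neumann_measurement (X : finType) (P : X -> 'End(V)) : Prop :=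
  [/\ forall x, projector (P x),
      forall x y, x != y -> (P x \o P y)%VF = 0
    & \sum_x P x = \1%VF].

End Operators.

Section Measurement.
Variables (R : realType) (V : vectType R[i]) (X : finType).

Definition reversible_measurement (a : R) (P : X -> 'End(V)) (x : X) :
    'End(V) :=
  (1 - (#|X|%:R - 1) * a)%:C *: P x + \sum_(y | y != x) a%:C *: P y.

(* When E x and rho are self-adjoint the trace is real, and taking its real
   part only changes its type from R[i] to R. *)
Definition outcome_distribution (E : X -> 'End(V)) (rho : 'End(V)) (x : X) :
    R :=
  complex.Re (lftrace (E x \o rho)%VF).

End Measurement.

Section Entropy.
Variable R : realType.

Definition log2 (t : R) : R := ln t / ln 2.

(* ln 0 = 0, so that 0 * log2 0 = 0. *)
Definition shannon_entropy (X : finType) (p : X -> R) : R :=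
  - \sum_x p x * log2 (p x).

Definition neg_tlog2t (t : R) : R := - t * log2 t.

End Entropy.

(* Main.v *)
Require Import Defs.
From HB Require Import structures.
From mathcomp Require Import all_boot all_order all_algebra.
From mathcomp Require Import complex.
From mathcomp Require Import boolp classical_sets reals exp.
From mathcomp Require Import ring lra.

Set Implicit Arguments.
Unset Strict Implicit.
Unset Printing Implicit Defensive.

Import Order.TTheory GRing.Theory Num.Theory.

Local Open Scope ring_scope.
Local Open Scope complex_scope.

(* With q = (1 - n a) p + a, both entropy bounds hold term by term.  The upper
   bound for H(p) is the tangent-line form of the concavity of f at the uniform
   distribution: p ln p - q ln q >= (p - q) (1 + ln (1/n)), and the right-hand
   side sums to 0.  For the lower bound, g(t) = f((1 - n a) t + a) - f(t) lies
   below its chord on [0, 1], whose end values are g(0) = f(a) and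
   g(1) = f(1 - n a + a). *)

(** * Linearity and cyclicity of the trace *)

Section TraceTheory.
Import passmx.
Variables (F : fieldType) (V : vectType F).

Lemma lftraceD (A B : 'End(V)) : lftrace (A + B) = lftrace A + lftrace B.
Proof. by rewrite /lftrace linearD mxtraceD. Qed.

Lemma lftraceZ (c : F) (A : 'End(V)) : lftrace (c *: A) = c * lftrace A.
Proof. by rewrite /lftrace linearZ mxtraceZ. Qed.

Lemma lftrace_sum (I : Type) (r : seq I) (D : pred I) (E : I -> 'End(V)) :
  lftrace (\sum_(i <- r | D i) E i) = \sum_(i <- r | D i) lftrace (E i).
Proof.
apply: (big_morph _ lftraceD).
by rewrite /lftrace linear0 mxtrace0.
Qed.

Lemma comp_lfun_suml (I : Type) (r : seq I) (D : pred I) (E : I -> 'End(V))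
    (B : 'End(V)) :
  ((\sum_(i <- r | D i) E i) \o B)%VF = \sum_(i <- r | D i) (E i \o B)%VF.
Proof.
by apply: (big_morph (fun A : 'End(V) => A \o B)%VF) => [A A'|];
  rewrite ?comp_lfunDl ?comp_lfun0l.
Qed.

Lemma lftraceC (A B : 'End(V)) : lftrace (A \o B)%VF = lftrace (B \o A)%VF.
Proof.
have bP := vbasisP {:V}.
by rewrite /lftrace !(mxof_comp _ _ bP) mxtrace_mulC.
Qed.

Lemma lftrace_coord (e : (\dim {:V}).-tuple V) (A : 'End(V)) :
  basis_of {:V} e -> lftrace A = \sum_i coord e i (A e`_i).
Proof.
move=> eP; rewrite (lftrace_basis _ eP); apply: eq_bigr => i _.
by rewrite !mxE /= vecof_delta.
Qed.

End TraceTheory.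

(** * Orthogonal bases and the trace of positive operators *)

Section PositiveOperators.
Variables (R : realType) (V : vectType R[i]) (dot : inner_product V).

(** Gram-Schmidt: below full dimension some [v] lies outside the span of [S], so its component [Y]
    orthogonal to [S] is nonzero and extends the family. *)
Lemma exists_pairwise_orthogonal k : (k <= \dim {:V})%N ->
  exists2 S : seq V, pairwise_orthogonal dot S & size S = k.
Proof.
elim: k => [|k IHk] lt_k; first by exists [::].
have [S oS sS] := IHk (ltnW lt_k).
have [v vS] : exists v, v \notin <<S>>%VS.
  have : ~~ ({:V} <= <<S>>)%VS.
    apply: contraTN lt_k => /dimvS le_dim.
    by rewrite -leqNgt -sS (leq_trans le_dim) ?dim_span.
  by case/subvPn => v _ vS; exists v.
have [X SX [Y [vE _ oYS]]] := orthogonal_split dot S v.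
exists (Y :: S); last by rewrite /= sS.
rewrite -cat1s pairwise_orthogonal_cat oS oYS /pairwise_orthogonal /= inE !andbT.
by apply: contraNneq vS => Y0; rewrite vE -Y0 addr0.
Qed.

(** An orthogonal family is free, so this one is a basis; pairing [A S_i] with [S_i] kills every
    coordinate but the [i]-th. Dividing by the squared norm avoids normalizing the basis. *)
Lemma lftrace_dot (S : (\dim {:V}).-tuple V) (A : 'End(V)) :
  pairwise_orthogonal dot S ->
  lftrace A = \sum_(i < \dim {:V}) dot (A S`_i) S`_i / dot S`_i S`_i.
Proof.
move=> oS; have fS := orthogonal_free oS.
have bS : basis_of {:V} S by rewrite basisEfree fS subvf size_tuple leqnn.
rewrite (lftrace_coord _ bS); apply: eq_bigr => i _.
have /pairwise_orthogonalP[/= /andP[S0 uS] oSS] := oS.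
have Si (j : 'I_(\dim {:V})) : S`_j \in S by rewrite mem_nth ?size_tuple.
have nz : dot S`_i S`_i != 0 by rewrite dnorm_eq0; apply: contraNneq S0 => <-.
apply: (mulIf nz); rewrite divfK //.
rewrite [in RHS](coord_basis bS (memvf (A S`_i))) linear_sumlz (bigD1 i) //=.
rewrite linearZl_LR big1 ?addr0 // => j ji.
by rewrite linearZl_LR /= oSS ?mulr0 // nth_uniq ?size_tuple.
Qed.

Lemma lftrace_ge0 (A : 'End(V)) :
  (forall v, 0 <= dot (A v) v) -> 0 <= lftrace A.
Proof.
move=> A0; have [S oS sS] := exists_pairwise_orthogonal (leqnn _).
rewrite (lftrace_dot (S := Tuple (introT eqP sS)) _ oS).
by apply: sumr_ge0 => i _; rewrite divr_ge0 // dnorm_ge0.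
Qed.

(* Tr (P rho) = Tr (P rho P) by cyclicity, and P rho P is positive. *)
Lemma lftrace_projector_ge0 (P rho : 'End(V)) :
  projector dot P -> positive_semidefinite dot rho ->
  0 <= lftrace (P \o rho)%VF.
Proof.
move=> [saP PP] [_ rho0]; rewrite -PP -comp_lfunA lftraceC.
by apply: lftrace_ge0 => v; rewrite !comp_lfunE /= saP.
Qed.

End PositiveOperators.

(** * Real parts of complex numbers *)

Section ComplexRe.
Variable R : realType.

Lemma ReD (z w : R[i]) : complex.Re (z + w) = complex.Re z + complex.Re w.
Proof. by case: z w => [? ?] [? ?]. Qed.

Lemma Re_realM (c : R) (z : R[i]) : complex.Re (c%:C * z) = c * complex.Re z.
Proof. by case: z => u v /=; rewrite mul0r subr0. Qed.

Lemma Re_sum (I : Type) (r : seq I) (D : pred I) (F : I -> R[i]) :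
  complex.Re (\sum_(i <- r | D i) F i) = \sum_(i <- r | D i) complex.Re (F i).
Proof. exact: (big_morph _ ReD). Qed.

End ComplexRe.

(** * Outcome probabilities of the two measurements *)

Section OutcomeDistribution.
Variables (R : realType) (V : vectType R[i]) (dot : inner_product V).
Variables (X : finType) (P : X -> 'End(V)) (rho : 'End(V)).
Hypotheses (hrho : quantum_state dot rho) (hP : von_neumann_measurement dot P).

Let p := outcome_distribution P rho.

Lemma outcome_distribution_ge0 x : 0 <= p x.
Proof.
have [prP _ _] := hP; have [rho0 _] := hrho.
have := lftrace_projector_ge0 (prP x) rho0.
by rewrite lecE => /andP[].
Qed.

Lemma sum_outcome_distribution : \sum_x p x = 1.
Proof.
have [_ _ sP] := hP; have [_ tr1] := hrho.
have : complex.Re (lftrace ((\sum_x P x) \o rho)%VF) = 1.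
  by rewrite sP comp_lfun1l tr1.
by rewrite comp_lfun_suml lftrace_sum Re_sum.
Qed.

Lemma outcome_distribution_reversible (a : R) x :
  outcome_distribution (reversible_measurement a P) rho x =
  (1 - #|X|%:R * a) * p x + a.
Proof.
have -> : outcome_distribution (reversible_measurement a P) rho x =
    (1 - (#|X|%:R - 1) * a) * p x + a * \sum_(y | y != x) p y.
  rewrite /outcome_distribution comp_lfunDl -comp_lfunZl comp_lfun_suml.
  rewrite lftraceD lftraceZ lftrace_sum ReD Re_sum /= Re_realM mulr_sumr.
  by congr (_ + _); apply: eq_bigr => y _; rewrite -comp_lfunZl lftraceZ Re_realM.
(* Normalization turns the sum over [y != x] into [1 - p x]. *)
have := sum_outcome_distribution; rewrite (bigD1 x) //= => /(canRL (addKr _)) ->.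
ring.
Qed.

End OutcomeDistribution.

(** * Pointwise logarithmic inequalities and the entropy bounds *)

Section EntropyBounds.
Variable R : realType.
Implicit Types (a b t q c n : R).

Lemma ler_ln_pos (x y : R) : 0 < x -> x <= y -> ln x <= ln y.
Proof. by move=> x0 xy; rewrite ler_ln ?posrE // (lt_le_trans x0). Qed.

(** Pointwise Gibbs inequality: for [t > 0], multiply [ln s <= s - 1] at [s = q / t] by [t]; at
    [t = 0] it reads [- q <= 0]. *)
Lemma mulr_ln_div_ge t q : 0 <= t -> 0 < q -> t - q <= t * (ln t - ln q).
Proof.
rewrite le_eqVlt => /predU1P[<- q0|t0 q0]; first by rewrite mul0r; lra.
have : ln (q / t) <= q / t - 1.
  have := @le_ln1Dx R (q / t - 1); rewrite addrCA subrr addr0; apply.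
  by rewrite ltrBrDr addNr divr_gt0.
rewrite ln_div ?posrE // => /(ler_wpM2l (ltW t0)).
rewrite [leRHS]mulrBr [t * (q / t)]mulrC divfK ?gt_eqF //; lra.
Qed.

(* ln q - ln c and t - c have the same sign, since q - c = (1 - n a) (t - c)
   when n c = 1. *)
Lemma tlnt_mix_ge a c n t (q := (1 - n * a) * t + a) :
  0 < a -> 0 < n -> n * a <= 1 -> n * c = 1 -> 0 <= t ->
  (t - q) * (1 + ln c) <= t * ln t - q * ln q.
Proof.
move=> a0 n0 na nc t0.
have b0 : 0 <= 1 - n * a by rewrite subr_ge0.
have q0 : 0 < q by rewrite /q ltr_wpDl ?mulr_ge0.
have c0 : 0 < c by rewrite -(pmulr_rgt0 _ n0) nc.
have tq : t - q = a * (n * (t - c)) by rewrite /q mulrBr nc; ring.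
have qc : q - c = (1 - n * a) * (t - c).
  by have : a * (n * c) = a; [rewrite nc mulr1 | rewrite /q; lra].
have := mulr_ln_div_ge t0 q0.
(* The right side minus the left is [t * (ln t - ln q) - (t - q)], nonnegative by the Gibbs bound,
   plus this product. *)
suff : 0 <= (t - q) * (ln q - ln c) by lra.
rewrite tq -!mulrA; apply: mulr_ge0; first exact: ltW.
apply: mulr_ge0; first exact: ltW.
case: (lerP c t) => tc.
  apply: mulr_ge0; first lra.
  by rewrite subr_ge0 ler_ln_pos // -subr_ge0 qc mulr_ge0 ?subr_ge0.
apply: mulr_le0; first lra.
by rewrite subr_le0 ler_ln_pos // -subr_le0 qc mulr_ge0_le0 // subr_le0 ltW.
Qed.

(* The left-hand side is convex in t, and the right-hand side is its chord
   over [0, 1].  With q = t (a + b) + (1 - t) a, the claim reads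
   t (a + b) (ln q - ln (a + b)) + (1 - t) a (ln q - ln a) >= t ln t, where
   a <= q and t (a + b) <= q. *)
Lemma neg_tlnt_affine_le a b t (q := b * t + a) :
  0 < a -> 0 <= b -> a + b <= 1 -> 0 <= t <= 1 ->
  - q * ln q + t * ln t <=
  t * (- (b + a) * ln (b + a)) + (1 - t) * (- a * ln a).
Proof.
move=> a0 b0 ab1 /andP[t0 t1].
have bt : 0 <= b * t by rewrite mulr_ge0.
have bt' : b * t <= b by rewrite ler_piMr.
have q0 : 0 < q by rewrite /q; lra.
have ab0 : 0 < b + a by lra.
have h1 : 0 <= (1 - t) * a * (ln q - ln a).
  apply: mulr_ge0; first by rewrite mulr_ge0 ?subr_ge0 // ltW.
  by rewrite subr_ge0 ler_ln_pos // /q; lra.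
have h2 : t * ln t <= t * (b + a) * (ln q - ln (b + a)).
  move: t0; rewrite le_eqVlt => /predU1P[<-|t0]; first by rewrite !mul0r.
  rewrite -mulrA ler_wpM2l //; first exact: ltW.
  have lnt : ln t <= ln q - ln (b + a).
    rewrite lerBrDr -lnM ?posrE // ler_ln_pos ?mulr_gt0 // /q.
    have := ler_wpM2r (ltW a0) t1; lra.
  (* As [q <= b + a <= 1], the number [ln q - ln (b + a)] is nonpositive, so scaling it by [b + a]
     does not decrease it. *)
  apply: (le_trans lnt); rewrite -subr_ge0.
  have -> : (b + a) * (ln q - ln (b + a)) - (ln q - ln (b + a)) =
    (1 - (b + a)) * (ln (b + a) - ln q) by ring.
  apply: mulr_ge0; first lra.
  by rewrite subr_ge0 ler_ln_pos // /q; lra.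
rewrite /q in h1 h2 *; lra.
Qed.

Lemma ln2_gt0 : 0 < ln 2 :> R.
Proof. by rewrite ln_gt0 // ltr1n. Qed.

Lemma shannon_entropyE (X : finType) (p : X -> R) :
  shannon_entropy p = \sum_x neg_tlog2t (p x).
Proof.
by rewrite /shannon_entropy -sumrN; apply: eq_bigr => x _; rewrite -mulNr.
Qed.

Lemma neg_tlog2tE t : neg_tlog2t t = - t * ln t / ln 2.
Proof. by rewrite /neg_tlog2t /log2 mulrA. Qed.

Variables (X : finType) (p : X -> R) (a : R).
Hypotheses (p0 : forall x, 0 <= p x) (p1 : \sum_x p x = 1).
Hypothesis ha : 0 < a < #|X|%:R^-1.

Let n : R := #|X|%:R.
Let q x : R := (1 - n * a) * p x + a.

Let n_ge1 : 1 <= n.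
Proof.
(* If [X] were empty, [#|X|%:R^-1] would be [0^-1 = 0], leaving no room for [a]. *)
rewrite ler1n lt0n; apply: contraTneq ha => ->.
by rewrite invr0; apply/negP => /andP[] /lt_trans /[apply]; rewrite ltxx.
Qed.

Let n_gt0 : 0 < n := lt_le_trans ltr01 n_ge1.

Let na_lt1 : n * a < 1.
Proof. by case/andP: ha => _; rewrite -(ltr_pM2l n_gt0) mulfV ?gt_eqF. Qed.

Lemma shannon_entropy_mix_ge : shannon_entropy p <= shannon_entropy q.
Proof.
have [a0 _] := andP ha.
rewrite /shannon_entropy lerN2 -subr_ge0 -sumrB.
(* The tangent bound at the uniform value [n^-1], in base 2. Its sum vanishes because [q] has total
   [(1 - n * a) + n * a = 1]. *)
pose F x := (p x - q x) * (1 + ln n^-1) / ln 2.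
have F0 : \sum_x F x = 0.
  rewrite -!mulr_suml sumrB big_split /= -mulr_sumr p1 sumr_const.
  by rewrite -mulr_natl -/n; lra.
rewrite -[leLHS]F0; apply: ler_sum => x _; rewrite /F /log2 !mulrA -mulrBl.
rewrite ler_wpM2r ?invr_ge0 ?(ltW ln2_gt0) //.
by apply: tlnt_mix_ge; rewrite ?mulfV ?gt_eqF // ltW.
Qed.

Lemma shannon_entropy_mix_le :
  shannon_entropy q -
    n * Num.max (neg_tlog2t a) (neg_tlog2t (1 - n * a + a))
  <= shannon_entropy p.
Proof.
have [a0 _] := andP ha.
rewrite !shannon_entropyE lerBlDr -lerBlDl -sumrB.
set M := Num.max _ _; have -> : n * M = \sum_(x : X) M.
  by rewrite sumr_const mulr_natl.
apply: ler_sum => x _.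
have px1 : p x <= 1.
  by rewrite -p1 (bigD1 x) //= lerDl sumr_ge0.
have Ma : neg_tlog2t a <= M by rewrite le_max lexx.
have Mb : neg_tlog2t (1 - n * a + a) <= M by rewrite le_max lexx orbT.
(* Splitting [M] with the chord weights [p x] and [1 - p x] lets each endpoint value of the chord be
   bounded by [M] separately. *)
have -> : M = p x * M + (1 - p x) * M by ring.
have px1' : 0 <= 1 - p x by lra.
apply: le_trans (lerD (ler_wpM2l (p0 x) Mb) (ler_wpM2l px1' Ma)).
rewrite !neg_tlog2tE -mulrBl !mulrA -mulrDl.
rewrite ler_wpM2r ?invr_ge0 ?(ltW ln2_gt0) //.
have na : a <= n * a by rewrite ler_peMl // ltW.
have b0 : 0 <= 1 - n * a by rewrite subr_ge0 ltW.
have ab1 : a + (1 - n * a) <= 1 by rewrite addrCA gerDl subr_le0.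
have t01 : 0 <= p x <= 1 by rewrite p0.
have := neg_tlnt_affine_le a0 b0 ab1 t01; rewrite -/(q x); lra.
Qed.

End EntropyBounds.

Theorem mainTheorem3 (R : realType) (V : vectType R[i]) (dot : inner_product V)
    (rho : 'End(V)) (X : finType) (P : X -> 'End(V)) (a : R)
    (hrho : quantum_state dot rho) (hP : von_neumann_measurement dot P)
    (ha : 0 < a < #|X|%:R^-1) :
  let n : R := #|X|%:R in
  let p := outcome_distribution P rho in
  let pu := outcome_distribution (reversible_measurement a P) rho in
  let f := @neg_tlog2t R in
  (forall x, pu x = (1 - n * a) * p x + a) /\
  shannon_entropy pu - n * Num.max (f a) (f (1 - n * a + a))
    <= shannon_entropy p <= shannon_entropy pu.
Proof.
move=> n p pu f.
have puE x : pu x = (1 - n * a) * p x + a.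
  exact: outcome_distribution_reversible hrho hP a x.
have p0 := outcome_distribution_ge0 hrho hP.
have p1 := sum_outcome_distribution hrho hP.
split=> //; have -> : pu = fun x => (1 - n * a) * p x + a by apply/funext.
apply/andP; split.
  exact: shannon_entropy_mix_le p0 p1 ha.
exact: shannon_entropy_mix_ge p0 p1 ha.
Qed.
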